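(* Consider integers $n\ge 0$, $l\ge 1$ and $b$ with $2 \leq b \leq 10$. \begin{enumerate} \item The solutions $(n,b,l)$ of $N_{n} = (b+1)b^l-1$ are exactly $(9,4,1), (11,6,1)$; the corresponding values are $19$ and $41$. \item The solutions $(n,b,l)$ of $N_{n} = (b+1)b^l+1$ are exactly $(8,2,2), (8,3,1), (22,7,3)$; the corresponding values are $13$ and $2745$. \item The solutions $(n,b,l)$ of $N_{n} = (b-1)b^l-1$ are exactly $(0,2,1), (1,2,1), (2,2,1), (4,2,2), (9,5,1), (11,7,1)$; the corresponding values are $1, 3, 19, 41$. \item The solutions $(n,b,l)$ of $N_{n} = (b-1)b^l+1$ are exactly $(4,2,1), (7,2,3), (8,4,1), (9,3,2), (14,2,7)$; the corresponding values are $3, 9, 13, 19, 129$. \end{enumerate}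
   Context: $(N_n)_{n\ge 0}$ denotes Narayana's cows sequence: $N_0=N_1=N_2=1$ and $N_{n+3}=N_{n+2}+N_n$ for all $n\ge 0$. *)

(* Defs.v *)
From mathcomp Require Import all_boot.

(** Narayana's cows sequence. *)
Fixpoint narayana (n : nat) : nat :=
  match n with
  | 0 | 1 | 2 => 1
  | S (S (S k) as k2) => narayana k2 + narayana k
  end.

Lemma narayana_rec n : narayana n.+3 = narayana n.+2 + narayana n.
Proof. by []. Qed.

(* Main.v *)
(* If l is at least some small L(b), write the equation as
   N_n = (c b^L) b^l' + d with l' = l - L >= 0.  Reducing it modulo powers of b
   (where the power term vanishes) and modulo a few well-chosen primes p for
   which the period of N mod p and the order of b mod p have only small prime
   factors leaves fewer and fewer residue classes (n mod M, l' mod K), and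
   finally none.  The classes of the n with N_n = d, which no power of b
   excludes, are killed by any p prime to b c whose period divides M.  For
   l < L(b) the right-hand side is at most 2745 and n < 23. *)

Require Import Defs.
From Stdlib Require Import NArith Lia.
From mathcomp Require Import all_boot.

Set Implicit Arguments.
Unset Strict Implicit.
Unset Printing Implicit Defensive.

Local Open Scope N_scope.

(** * The sequence modulo [m], through powers of x modulo x^3 = x^2 + 1 *)

Lemma eqmodD m a a' b b' :
  a mod m = a' mod m -> b mod m = b' mod m -> (a + b) mod m = (a' + b') mod m.
Proof. by move=> Ha Hb; rewrite N.Div0.add_mod Ha Hb -N.Div0.add_mod. Qed.

Lemma eqmodM m a a' b b' :
  a mod m = a' mod m -> b mod m = b' mod m -> (a * b) mod m = (a' * b') mod m.
Proof. by move=> Ha Hb; rewrite N.Div0.mul_mod Ha Hb -N.Div0.mul_mod. Qed.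

Definition cow (n : N) : N := N.of_nat (narayana (N.to_nat n)).

Lemma cow3 n : cow (n + 3) = cow (n + 2) + cow n.
Proof.
rewrite /cow !Nnat.N2Nat.inj_add -Nnat.Nat2N.inj_add.
move: (N.to_nat n) => k.
by rewrite -[(k + N.to_nat 3)%coq_nat]/(addn k 3)
           -[(k + N.to_nat 2)%coq_nat]/(addn k 2) addn3 addn2 narayana_rec.
Qed.

Definition cubic : Type := N * N * N.

(* Product of A0 + A1 x + A2 x^2 and B0 + B1 x + B2 x^2 modulo
   x^3 = x^2 + 1 (hence x^4 = x^2 + x + 1), with coefficients modulo m. *)
Definition mulx (m : N) (A B : cubic) : cubic :=
  let '(a0, a1, a2) := A in let '(b0, b1, b2) := B in
  let c3 := a1 * b2 + a2 * b1 in let c4 := a2 * b2 in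
  ((a0 * b0 + c3 + c4) mod m, (a0 * b1 + a1 * b0 + c4) mod m,
   (a0 * b2 + a1 * b1 + a2 * b0 + c3 + c4) mod m).

Definition evalx (A : cubic) (k : N) : N :=
  let '(a0, a1, a2) := A in a0 * cow k + a1 * cow (k + 1) + a2 * cow (k + 2).

(* A acts as x^j: applying it to the sequence shifts the index by j modulo m. *)
Definition shifts (m : N) (A : cubic) (j : N) : Prop :=
  forall k, evalx A k mod m = cow (k + j) mod m.

(** The recurrence of [cow] matches x^3 = x^2 + 1, so the product evaluated at [k] combines the
    values of [A] at [k], [k + 1], [k + 2] with the coefficients of [B]; [A] then shifts each of
    them by [i]. *)
Lemma shifts_mulx m A B i j :
  shifts m A i -> shifts m B j -> shifts m (mulx m A B) (i + j).
Proof.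
move=> HA HB k; rewrite N.add_assoc -HB.
move: A B HA HB => [[a0 a1] a2] [[b0 b1] b2] HA HB.
transitivity ((b0 * evalx (a0, a1, a2) k + b1 * evalx (a0, a1, a2) (k + 1)
               + b2 * evalx (a0, a1, a2) (k + 2)) mod m).
  rewrite /mulx /evalx.
  transitivity (((a0 * b0 + (a1 * b2 + a2 * b1) + a2 * b2) * cow k
    + (a0 * b1 + a1 * b0 + a2 * b2) * cow (k + 1)
    + (a0 * b2 + a1 * b1 + a2 * b0 + (a1 * b2 + a2 * b1) + a2 * b2)
      * cow (k + 2)) mod m).
    by do !(apply: eqmodD || apply: eqmodM); rewrite ?N.Div0.mod_mod.
  congr (_ mod m).
  have -> : k + 1 + 1 = k + 2 by lia.
  have -> : k + 1 + 2 = k + 3 by lia.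
  have -> : k + 2 + 1 = k + 3 by lia.
  have -> : k + 2 + 2 = k + 1 + 3 by lia.
  rewrite !cow3; have -> : k + 1 + 2 = k + 3 by lia.
  rewrite cow3; ring.
rewrite [evalx (b0, _, _) _]/evalx; do !(apply: eqmodD || apply: eqmodM) => //.
- by rewrite (HA (k + 1)); congr (cow _ mod m); lia.
- by rewrite (HA (k + 2)); congr (cow _ mod m); lia.
Qed.

Definition powx (m n : N) : cubic :=
  if n is Npos p then Pos.iter_op (mulx m) p (0, 1, 0) else (1, 0, 0).

Lemma shifts_powx m n : shifts m (powx m n) n.
Proof.
(* [Pos.iter_op] is square-and-multiply: each binary digit squares the base, so the induction needs
   an arbitrary [A] and [j]. *)
have iterP p A j :
    shifts m A j -> shifts m (Pos.iter_op (mulx m) p A) (Npos p * j).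
  elim: p A j => [p IHp|p IHp|] A j HA.
  - have -> : Npos p~1 * j = j + Npos p * (j + j) by lia.
    exact: shifts_mulx HA (IHp _ _ (shifts_mulx HA HA)).
  - have -> : Npos p~0 * j = Npos p * (j + j) by lia.
    exact: IHp (shifts_mulx HA HA).
  - by rewrite N.mul_1_l.
case: n => [|p].
  by move=> k; rewrite N.add_0_r /evalx /powx; congr (_ mod m); lia.
rewrite -{2}[Npos p]N.mul_1_r; apply: iterP => k.
by rewrite /evalx; congr (_ mod m); lia.
Qed.

(** This is [evalx A 0], as the first three terms of the sequence are 1. *)
Definition sumx (A : cubic) : N := let '(a0, a1, a2) := A in a0 + a1 + a2.

Lemma sumxE m A n : shifts m A n -> sumx A mod m = cow n mod m.
Proof.
move/(_ 0); rewrite N.add_0_l => <-; case: A => [[a0 a1] a2].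
by rewrite /sumx /evalx /cow /= !N.mul_1_r.
Qed.

Lemma cow_period m M n i : powx m M = (1, 0, 0) ->
  cow (n + i * M) mod m = cow n mod m.
Proof.
move=> per; elim/N.peano_ind: i => [|i IHi].
  by rewrite N.mul_0_l N.add_0_r.
rewrite -IHi N.mul_succ_l N.add_assoc -(shifts_powx m M) per /evalx.
by congr (_ mod m); lia.
Qed.

(** * Powers of [b] modulo [m] *)

Definition powmod (m b e : N) : N :=
  if e is Npos p then Pos.iter_op (fun x y => (x * y) mod m) p b else 1.

Lemma powmodE m b e : powmod m b e mod m = b ^ e mod m.
Proof.
have iterP p x j : x mod m = b ^ j mod m ->
    Pos.iter_op (fun x y => (x * y) mod m) p x mod m = b ^ (Npos p * j) mod m.
  elim: p x j => [p IHp|p IHp|] x j Hx.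
  - have -> : Npos p~1 * j = j + Npos p * (j + j) by lia.
    rewrite [Pos.iter_op _ _ _]/= N.Div0.mod_mod N.pow_add_r.
    apply: eqmodM => //; apply: IHp.
    by rewrite N.Div0.mod_mod N.pow_add_r; apply: eqmodM.
  - have -> : Npos p~0 * j = Npos p * (j + j) by lia.
    by apply: IHp; rewrite N.Div0.mod_mod N.pow_add_r; apply: eqmodM.
  - by rewrite N.mul_1_l.
case: e => [//|p]; rewrite -{2}[Npos p]N.mul_1_r.
by apply: iterP; rewrite N.pow_1_r.
Qed.

(** Asking for a period of C b^l rather than of b^l lets [K = 1] serve when [m] divides [C], as
    happens in [base_steps]. *)
Lemma pow_period m b C K l j : (C * powmod m b K) mod m = C mod m ->
  (C * b ^ (l + j * K)) mod m = (C * b ^ l) mod m.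
Proof.
move=> per; elim/N.peano_ind: j => [|j IHj].
  by rewrite N.mul_0_l N.add_0_r.
rewrite -IHj N.mul_succ_l N.add_assoc [b ^ (_ + K)]N.pow_add_r.
rewrite [_ * b ^ K]N.mul_comm N.mul_assoc.
by apply: eqmodM => //; rewrite -per; apply: eqmodM => //; rewrite powmodE.
Qed.

(** * Sieving the residue classes of (n, l) *)

Lemma split_index M q i : 0 < q ->
  exists2 i0, i0 < q & exists i1, i * M = i0 * M + i1 * (M * q).
Proof.
move=> q_gt0; exists (i mod q); first by apply: N.mod_lt; lia.
by exists (i / q); rewrite {1}(N.div_mod i q); last lia; ring.
Qed.

Section Sieve.

(* The equation is cow n + e1 = C * b ^ l + e2: the term d = -1 or 1 is moved to
   the side where no subtraction occurs. *)
Variables b C e1 e2 : N.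

Definition covered (M K : N) (S : seq (N * N)) (n l : N) : Prop :=
  exists2 x, x \in S & exists i j, n = x.1 + i * M /\ l = x.2 + j * K.

(** A row pairs an index with its power of x, a column an exponent with the residue of C b^l; each
    new class thus costs one multiplication. *)
Definition next_row (m M : N) (G : cubic) (x : N * cubic) : N * cubic :=
  (x.1 + M, mulx m x.2 G).

Definition next_col (m K h : N) (y : N * N) : N * N :=
  (y.1 + K, (y.2 * h) mod m).

Lemma iter_next_row m M n A k : shifts m A n ->
  exists2 B, iter k (next_row m M (powx m M)) (n, A) = (n + N.of_nat k * M, B)
           & shifts m B (n + N.of_nat k * M).
Proof.
move=> HA; elim: k => [|k [B IHk HB]].
  by exists A; rewrite N.mul_0_l N.add_0_r.
exists (mulx m B (powx m M)).
  by rewrite iterS IHk /next_row; congr (_, _); rewrite [fst _]/=; lia.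
have -> : n + N.of_nat k.+1 * M = n + N.of_nat k * M + M by lia.
by apply: shifts_mulx => //; apply: shifts_powx.
Qed.

Lemma iter_next_col m K l y k : y mod m = (C * b ^ l) mod m ->
  exists2 z, iter k (next_col m K (powmod m b K)) (l, y)
             = (l + N.of_nat k * K, z)
           & z mod m = (C * b ^ (l + N.of_nat k * K)) mod m.
Proof.
move=> Hy; elim: k => [|k [z IHk Hz]].
  by exists y; rewrite N.mul_0_l N.add_0_r.
exists ((z * powmod m b K) mod m).
  by rewrite iterS IHk /next_col; congr (_, _); rewrite [fst _]/=; lia.
have -> : l + N.of_nat k.+1 * K = l + N.of_nat k * K + K by lia.
rewrite N.Div0.mod_mod N.pow_add_r N.mul_assoc.
by apply: eqmodM => //; apply: powmodE.
Qed.

Definition refine (m M qM K qK : N) (S : seq (N * N)) : seq (N * N) :=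
  let G := powx m M in let h := powmod m b K in
  flatten [seq
    let cols := traject (next_col m K h) (x.2, (C * powmod m b x.2) mod m)
                  (N.to_nat qK) in
    flatten [seq
      let v := (sumx row.2 + e1) mod m in
      [seq (row.1, col.1) | col <- cols & v =? (col.2 + e2) mod m]
    | row <- traject (next_row m M G) (x.1, powx m x.1) (N.to_nat qM)]
  | x <- S].

Definition periods (m M K : N) : bool :=
  (powx m M == (1, 0, 0)) && ((C * powmod m b K) mod m == C mod m).

(** The class of a solution splits into [qM * qK] finer ones. By periodicity, the representative of
    the one containing (n, l) satisfies the equation modulo [m], so that class is kept. *)
Lemma covered_refine m M qM K qK S n l :
    cow n + e1 = C * b ^ l + e2 -> 0 < qM -> 0 < qK ->
    periods m (M * qM) (K * qK) ->
  covered M K S n l -> covered (M * qM) (K * qK) (refine m M qM K qK S) n l.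
Proof.
move=> eq_nl qM_gt0 qK_gt0 /andP[/eqP perM /eqP perK].
case=> -[r s] /= rsS [i [j [def_n def_l]]].
have [i0 lt_i0 [i1 Ei]] := split_index M i qM_gt0.
have [j0 lt_j0 [j1 Ej]] := split_index K j qK_gt0.
rewrite Ei N.add_assoc in def_n; rewrite Ej N.add_assoc in def_l.
have [A rowE HA] := iter_next_row M (N.to_nat i0) (shifts_powx m r).
have [y colE Hy] : exists2 z, iter (N.to_nat j0) (next_col m K (powmod m b K))
      (s, (C * powmod m b s) mod m) = (s + N.of_nat (N.to_nat j0) * K, z)
    & z mod m = (C * b ^ (s + N.of_nat (N.to_nat j0) * K)) mod m.
  apply: iter_next_col; rewrite N.Div0.mod_mod.
  by apply: eqmodM => //; apply: powmodE.
rewrite !Nnat.N2Nat.id in rowE HA colE Hy.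
exists (r + i0 * M, s + j0 * K); last by exists i1, j1.
apply/flatten_mapP; exists (r, s) => //.
apply/flatten_mapP; exists (r + i0 * M, A).
  by apply/trajectP; exists (N.to_nat i0) => //; apply/ltP; lia.
apply/mapP; exists (s + j0 * K, y) => //; rewrite mem_filter; apply/andP; split.
  apply/N.eqb_spec; transitivity ((cow n + e1) mod m).
    by apply: eqmodD => //; rewrite (sumxE HA) def_n (cow_period _ _ perM).
  rewrite eq_nl def_l; apply: eqmodD => //.
  by rewrite (pow_period _ _ perK) Hy.
by apply/trajectP; exists (N.to_nat j0) => //; apply/ltP; lia.
Qed.

(* A step (m, qM, qK) refines M and K to M * qM and K * qK, which must be
   periods modulo m of n |-> cow n and l |-> C * b ^ l, and tests the equation
   modulo m. *)
Fixpoint sieve (M K : N) (S : seq (N * N)) (steps : seq (N * N * N)) : bool :=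
  if steps is (m, qM, qK) :: steps' then
    [&& 0 <? qM, 0 <? qK, periods m (M * qM) (K * qK)
      & sieve (M * qM) (K * qK) (refine m M qM K qK S) steps']
  else nilp S.

Lemma sieve_sound M K S steps n l :
  sieve M K S steps -> covered M K S n l -> cow n + e1 <> C * b ^ l + e2.
Proof.
move=> sv cov eq_nl.
elim: steps M K S sv cov => [|[[m qM] qK] steps IHsteps] M K S /=.
  by move=> /nilP-> [x].
case/and4P=> /N.ltb_spec0 qM_gt0 /N.ltb_spec0 qK_gt0 per sv cov.
exact: IHsteps sv (covered_refine eq_nl qM_gt0 qK_gt0 per cov).
Qed.

End Sieve.

(** * Certificates for the four equations *)

(** The last modulus in [base_steps b] is b to this exponent, so the power term vanishes in all of
    those steps. *)
Definition cutoff (b : N) : N :=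
  match b with 2 => 8 | 3 | 4 | 7 => 4 | 6 | 8 | 9 => 3 | _ => 2 end.

(* These steps and the four tables below come from a computer search. *)
Definition base_steps (b : N) : seq (N * N * N) :=
  match b with
  | 2 => [:: (2, 7, 1); (4, 2, 1); (8, 2, 1); (16, 2, 1); (32, 2, 1);
             (64, 2, 1); (128, 2, 1); (256, 2, 1)]
  | 3 => [:: (3, 8, 1); (9, 3, 1); (27, 3, 1); (81, 3, 1)]
  | 4 => [:: (4, 14, 1); (16, 4, 1); (64, 4, 1); (256, 4, 1)]
  | 5 => [:: (5, 31, 1); (25, 5, 1)]
  | 6 => [:: (6, 56, 1); (36, 3, 1); (216, 3, 1)]
  | 7 => [:: (7, 57, 1); (49, 7, 1); (343, 7, 1); (2401, 7, 1)]
  | 8 => [:: (8, 28, 1); (64, 8, 1); (512, 8, 1)]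
  | 9 => [:: (9, 24, 1); (81, 9, 1); (729, 9, 1)]
  | _ => [:: (10, 217, 1); (100, 10, 1)]
  end.

Definition succ_pred_steps (b : N) : seq (N * N * N) :=
  match b with
  | 2 => [:: (127, 9, 7)]
  | 3 => [:: (13, 7, 3)]
  | 4 => [:: (3, 1, 1)]
  | 5 => [:: (1117, 9, 372); (1303, 14, 1)]
  | 6 => [:: (13, 1, 12)]
  | 7 => [:: (3823, 26, 98)]
  | 8 => [:: (13, 3, 4)]
  | 9 => [:: (13, 7, 3)]
  | _ => [:: (4093, 66, 22); (67, 1, 3)]
  end.

Definition succ_succ_steps (b : N) : seq (N * N * N) :=
  match b with
  | 2 => [:: (127, 9, 7); (2017, 1, 48)]
  | 3 => [:: (577, 8, 48); (13, 7, 1)]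
  | 4 => [:: (3, 1, 1)]
  | 5 => [:: (521, 104, 10); (61, 1, 3)]
  | 6 => [:: (379, 3, 63); (127, 4, 2)]
  | 7 => [:: (3823, 26, 98); (13721, 20, 14)]
  | 8 => [:: (13, 3, 4)]
  | 9 => [:: (577, 8, 24); (17, 1, 1)]
  | _ => [:: (3, 4, 1); (4093, 33, 22); (23, 2, 1)]
  end.

Definition pred_pred_steps (b : N) : seq (N * N * N) :=
  match b with
  | 2 => [:: (3, 1, 2)]
  | 3 => [:: (12853, 119, 51)]
  | 4 => [:: (13, 3, 6)]
  | 5 => [:: (1741, 348, 15); (11, 1, 1); (4651, 5, 155)]
  | 6 => [:: (13, 1, 12)]
  | 7 => [:: (3823, 26, 98); (37, 3, 9)]
  | 8 => [:: (3, 1, 2)]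
  | 9 => [:: (577, 8, 24)]
  | _ => [:: (4093, 66, 22); (11, 1, 1)]
  end.

Definition pred_succ_steps (b : N) : seq (N * N * N) :=
  match b with
  | 2 => [:: (3, 1, 2)]
  | 3 => [:: (577, 8, 48); (13, 7, 1)]
  | 4 => [:: (13, 3, 6)]
  | 5 => [:: (521, 104, 10); (3, 1, 1); (61, 1, 3)]
  | 6 => [:: (937, 13, 26); (53, 1, 1)]
  | 7 => [:: (3823, 26, 98); (6917, 2, 247)]
  | 8 => [:: (3, 1, 2)]
  | 9 => [:: (577, 8, 24); (17, 1, 1)]
  | _ => [:: (11, 6, 2); (4093, 11, 11)]
  end.

(** The exponent sieved is l - [cutoff b], and the search starts from the single class modulo 1. *)
Definition certified (c : N -> N) (e1 e2 : N) (steps : N -> seq (N * N * N))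
    (b : N) : bool :=
  sieve b (c b * b ^ cutoff b) e1 e2 1 1 [:: (0, 0)] (base_steps b ++ steps b).

Lemma certified_cutoff c e1 e2 steps b n l :
    certified c e1 e2 steps b -> cow n + e1 = c b * b ^ l + e2 ->
  l < cutoff b.
Proof.
move=> cert eq_nl; case: (N.lt_ge_cases l (cutoff b)) => // le_l.
have El : l = cutoff b + (l - cutoff b) by lia.
have cov : covered 1 1 [:: (0, 0)] n (l - cutoff b).
  exists (0, 0); first by rewrite inE.
  by exists n, (l - cutoff b); rewrite !N.mul_1_r !N.add_0_l.
case: (sieve_sound cert cov).
by rewrite -N.mul_assoc -N.pow_add_r -El.
Qed.

Definition bases : seq N := [:: 2; 3; 4; 5; 6; 7; 8; 9; 10].

(** In the four names, the first word gives the factor b + 1 or b - 1, the second the term d = -1 or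
    1. *)
Lemma succ_pred_certified :
  all (certified (fun b => b + 1) 1 0 succ_pred_steps) bases.
Proof. by vm_compute. Qed.

Lemma succ_succ_certified :
  all (certified (fun b => b + 1) 0 1 succ_succ_steps) bases.
Proof. by vm_compute. Qed.

Lemma pred_pred_certified :
  all (certified (fun b => b - 1) 1 0 pred_pred_steps) bases.
Proof. by vm_compute. Qed.

Lemma pred_succ_certified :
  all (certified (fun b => b - 1) 0 1 pred_succ_steps) bases.
Proof. by vm_compute. Qed.

Local Close Scope N_scope.

(** * Exponents below the cutoff, and the theorem *)

Lemma of_nat_expn b l : N.of_nat (b ^ l) = (N.of_nat b ^ N.of_nat l)%num.
Proof.
elim: l => [//|l IHl].
by rewrite expnS Nnat.Nat2N.inj_mul IHl Nnat.Nat2N.inj_succ N.pow_succ_r'.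
Qed.

Lemma narayana_homo : {homo narayana : m n / m <= n}.
Proof.
apply: homo_leq leqnn leq_trans _ => -[|[|[|n]]] //.
by rewrite narayana_rec leq_addr.
Qed.

Definition cutoffn (b : nat) : nat := N.to_nat (cutoff (N.of_nat b)).

(** The bound 2745 = 8 * 7^3 + 1 is the 22nd term of the sequence, hence the range n < 23. *)
Definition small_solutions_in (f : nat -> nat -> nat)
    (sols : seq (nat * nat * nat)) : bool :=
  all (fun b => all (fun l => (f b l <= 2745) &&
    all (fun n => (narayana n == f b l) ==> ((n, b, l) \in sols)) (iota 0 23))
    (iota 1 (cutoffn b).-1)) (iota 2 9).

Lemma solutionsP f c e1 e2 steps sols n b l :
    all (certified c e1 e2 steps) bases -> small_solutions_in f sols ->
    all (fun x => narayana x.1.1 == f x.1.2 x.2) sols ->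
    1 <= l -> 2 <= b <= 10 ->
    (N.of_nat (f b l) + e1
     = c (N.of_nat b) * N.of_nat b ^ N.of_nat l + e2)%num ->
  narayana n = f b l <-> (n, b, l) \in sols.
Proof.
move=> /allP cert /allP small /allP valid l_gt0 b_bnd fE.
split=> [eq_n|/valid/eqP//].
have b_in : b \in iota 2 9 by rewrite mem_iota.
have bN_in : N.of_nat b \in bases.
  by rewrite -[bases]/(map N.of_nat (iota 2 9)) map_f.
have eqN : (cow (N.of_nat n) + e1
            = c (N.of_nat b) * N.of_nat b ^ N.of_nat l + e2)%num.
  by rewrite -fE -eq_n /cow Nnat.Nat2N.id.
have lt_l : l < cutoffn b.
  have lt_lN := certified_cutoff (cert _ bN_in) eqN.
  by rewrite /cutoffn; apply/ltP; lia.
have l_in : l \in iota 1 (cutoffn b).-1.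
  by rewrite mem_iota l_gt0 add1n prednK // (leq_ltn_trans _ lt_l).
have /andP[f_le /allP/(_ n)] := allP (small b b_in) l l_in.
(* If n were at least 23, monotonicity would give 4023, the 23rd term, as a lower bound for a value
   at most 2745. *)
rewrite eq_n eqxx; apply; rewrite mem_iota /= ltnNge; apply/negP => n_ge.
have := narayana_homo n_ge; rewrite eq_n => /leq_trans/(_ f_le).
by vm_compute.
Qed.

Theorem theorem5p1 :
  ((forall n b l : nat, 1 <= l -> 2 <= b <= 10 ->
      (narayana n = (b + 1) * b ^ l - 1 <->
       (n, b, l) \in [:: (9, 4, 1); (11, 6, 1)]))
   /\ narayana 9 = 19 /\ narayana 11 = 41)
  /\
  ((forall n b l : nat, 1 <= l -> 2 <= b <= 10 ->
      (narayana n = (b + 1) * b ^ l + 1 <->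
       (n, b, l) \in [:: (8, 2, 2); (8, 3, 1); (22, 7, 3)]))
   /\ narayana 8 = 13 /\ narayana 22 = 2745)
  /\
  ((forall n b l : nat, 1 <= l -> 2 <= b <= 10 ->
      (narayana n = (b - 1) * b ^ l - 1 <->
       (n, b, l) \in [:: (0, 2, 1); (1, 2, 1); (2, 2, 1); (4, 2, 2);
                         (9, 5, 1); (11, 7, 1)]))
   /\ narayana 0 = 1 /\ narayana 1 = 1 /\ narayana 2 = 1
   /\ narayana 4 = 3 /\ narayana 9 = 19 /\ narayana 11 = 41)
  /\
  ((forall n b l : nat, 1 <= l -> 2 <= b <= 10 ->
      (narayana n = (b - 1) * b ^ l + 1 <->
       (n, b, l) \in [:: (4, 2, 1); (7, 2, 3); (8, 4, 1); (9, 3, 2);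
                         (14, 2, 7)]))
   /\ narayana 4 = 3 /\ narayana 7 = 9 /\ narayana 8 = 13
   /\ narayana 9 = 19 /\ narayana 14 = 129).
Proof.
split; [|split; [|split]]; (split; last by vm_compute) => n b l l_gt0 b_bnd;
  (* Positivity of the factors ensures that the truncated subtraction of 1 is undone by adding 1. *)
  have [bl_gt0 b1_gt0] : 0 < b ^ l /\ 0 < b - 1
    by case/andP: b_bnd => b_gt1 _; rewrite expn_gt0 subn_gt0 (ltnW b_gt1).
- refine (solutionsP (f := fun b l => (b + 1) * b ^ l - 1)
            n succ_pred_certified _ _ l_gt0 b_bnd _); [by vm_compute..|].
  cbv beta; rewrite -of_nat_expn -[1%num]/(N.of_nat 1) N.add_0_r.
  rewrite -!(Nnat.Nat2N.inj_add, Nnat.Nat2N.inj_sub, Nnat.Nat2N.inj_mul).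
  congr N.of_nat; apply: subnK.
  by rewrite muln_gt0 bl_gt0 addn1.
- refine (solutionsP (f := fun b l => (b + 1) * b ^ l + 1)
            n succ_succ_certified _ _ l_gt0 b_bnd _); [by vm_compute..|].
  cbv beta; rewrite -of_nat_expn -[1%num]/(N.of_nat 1) N.add_0_r.
  rewrite -!(Nnat.Nat2N.inj_add, Nnat.Nat2N.inj_sub, Nnat.Nat2N.inj_mul).
  by congr N.of_nat.
- refine (solutionsP (f := fun b l => (b - 1) * b ^ l - 1)
            n pred_pred_certified _ _ l_gt0 b_bnd _); [by vm_compute..|].
  cbv beta; rewrite -of_nat_expn -[1%num]/(N.of_nat 1) N.add_0_r.
  rewrite -!(Nnat.Nat2N.inj_add, Nnat.Nat2N.inj_sub, Nnat.Nat2N.inj_mul).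
  congr N.of_nat; apply: subnK.
  by rewrite muln_gt0 bl_gt0 b1_gt0.
- refine (solutionsP (f := fun b l => (b - 1) * b ^ l + 1)
            n pred_succ_certified _ _ l_gt0 b_bnd _); [by vm_compute..|].
  cbv beta; rewrite -of_nat_expn -[1%num]/(N.of_nat 1) N.add_0_r.
  rewrite -!(Nnat.Nat2N.inj_add, Nnat.Nat2N.inj_sub, Nnat.Nat2N.inj_mul).
  by congr N.of_nat.
Qed.
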